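(* If $n=2\nu$ is even, then $M\in\mathbb{R}^{n\times n}$ is an element of $S_n$ if and only if $$M=\mathcal{X}_n\begin{pmatrix}Y&V^T\\ W&Z\end{pmatrix}\mathcal{X}_n$$ for some $Y\in S_\nu$, some $V,W\in\mathbb{R}^{\nu\times\nu}$ with row sums $0$, and some $Z\in\mathbb{R}^{\nu\times\nu}$. If $n=2\nu+1$ is odd, then $M\in\mathbb{R}^{n\times n}$ is an element of $S_n$ if and only if $$M=\mathcal{X}_n\begin{pmatrix}Y+2w\mathcal{E}_\nu&\sqrt2\,(w1_\nu-Y1_\nu)&V^T\\ \sqrt2\,(w1_\nu-Y^T1_\nu)^T&w+2\,1_\nu^TY1_\nu&-\sqrt2\,(V1_\nu)^T\\ W&-\sqrt2\,W1_\nu&Z\end{pmatrix}\mathcal{X}_n$$ with arbitrary $V,W,Y,Z\in\mathbb{R}^{\nu\times\nu}$ and $w\in\mathbb{R}$; here $w$ is the weight of $M$.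
   Context: $S_n$ is the space of matrices $M\in\mathbb{R}^{n\times n}$ for which there is $w\in\mathbb{R}$, called the weight, such that $\sum_{j=1}^nM_{i,j}=\sum_{j=1}^nM_{j,i}=nw$ for all $i\in\{1,\dots,n\}$. $1_\nu$ and $0_\nu$ are the all-ones and null column vectors in $\mathbb{R}^\nu$; $\mathcal{E}_\nu$ is the $\nu\times\nu$ matrix with all entries $1$; $\mathcal{I}_\nu$ is the $\nu\times\nu$ unit matrix; $\mathcal{J}_\nu=(\delta_{i,\nu+1-j})_{i,j=1}^\nu$ (ones on the antidiagonal, zeros elsewhere); and $$\mathcal{X}_n=\frac1{\sqrt2}\begin{pmatrix}\mathcal{I}_\nu&\mathcal{J}_\nu\\ \mathcal{J}_\nu&-\mathcal{I}_\nu\end{pmatrix}\ (n=2\nu),\qquad \mathcal{X}_n=\begin{pmatrix}\frac1{\sqrt2}\mathcal{I}_\nu&0_\nu&\frac1{\sqrt2}\mathcal{J}_\nu\\ 0_\nu^T&1&0_\nu^T\\ \frac1{\sqrt2}\mathcal{J}_\nu&0_\nu&-\frac1{\sqrt2}\mathcal{I}_\nu\end{pmatrix}\ (n=2\nu+1).$$ *)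

(* Defs.v *)
From mathcomp Require Import all_boot all_order all_algebra.
From mathcomp Require Import reals.

Set Implicit Arguments.
Unset Strict Implicit.
Unset Printing Implicit Defensive.

Import GRing.Theory Num.Theory.
Local Open Scope ring_scope.

(* For n > 0 the weight is unique; the 0 x 0 matrix has every real as weight. *)
Definition is_weight (R : realType) (n : nat) (M : 'M[R]_n) (w : R) : Prop :=
  forall i : 'I_n,
    \sum_(j < n) M i j = n%:R * w /\ \sum_(j < n) M j i = n%:R * w.

Definition in_S (R : realType) (n : nat) (M : 'M[R]_n) : Prop :=
  exists w : R, is_weight M w.

Definition row_sums_zero (R : realType) (m n : nat) (A : 'M[R]_(m, n)) : Prop :=
  forall i : 'I_m, \sum_(j < n) A i j = 0.

Definition ones (R : realType) (nu : nat) : 'cV[R]_nu := const_mx 1.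

Definition onesmx (R : realType) (nu : nat) : 'M[R]_nu := const_mx 1.

(* With indices from 0, rev_ord j = nu - 1 - j; this is nu + 1 - j when they
   start from 1. *)
Definition antidiag (R : realType) (nu : nat) : 'M[R]_nu :=
  \matrix_(i < nu, j < nu) (i == rev_ord j)%:R.

(* X_even and X_odd are X_n for n = 2 nu and n = 2 nu + 1; n is written nu + nu,
   resp. nu + (1 + nu), to match the sizes produced by block_mx. *)
Definition X_even (R : realType) (nu : nat) : 'M[R]_(nu + nu) :=
  (Num.sqrt 2)^-1 *:
    block_mx 1%:M            (antidiag R nu)
             (antidiag R nu) (- 1%:M).

Definition block3_mx (R : realType) (nu : nat)
    (A11 : 'M[R]_nu)  (a12 : 'cV[R]_nu) (A13 : 'M[R]_nu)
    (a21 : 'rV[R]_nu) (a22 : R)         (a23 : 'rV[R]_nu)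
    (A31 : 'M[R]_nu)  (a32 : 'cV[R]_nu) (A33 : 'M[R]_nu) :
    'M[R]_(nu + (1 + nu)) :=
  block_mx A11              (row_mx a12 A13)
           (col_mx a21 A31) (block_mx a22%:M a23 a32 A33).

Definition X_odd (R : realType) (nu : nat) : 'M[R]_(nu + (1 + nu)) :=
  let s := (Num.sqrt 2)^-1 in
  block3_mx (s *: 1%:M)         0 (s *: antidiag R nu)
            0                   1 0
            (s *: antidiag R nu) 0 (- (s *: 1%:M)).

(* The 1 x 1 matrix 1^T Y 1 is read as a scalar through its only entry. *)
Definition odd_block (R : realType) (nu : nat) (V W Y Z : 'M[R]_nu) (w : R) :
    'M[R]_(nu + (1 + nu)) :=
  let e := ones R nu in
  let r := Num.sqrt 2 in
  block3_mx
    (Y + (2 * w) *: onesmx R nu)     (r *: (w *: e - Y *m e))             V^T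
    (r *: (w *: e - Y^T *m e)^T)     (w + 2 * (e^T *m Y *m e) 0 0)  (- (r *: (V *m e)^T))
    W                                (- (r *: (W *m e)))                  Z.

(* Main.v *)
(** The matrix X_n is a symmetric involution, so M = X_n B X_n has weight w iff
    X_n 1_n is an eigenvector of both B and B^T with eigenvalue n w.  Moreover
    X_n 1_n = (sqrt 2 1_nu, 0_nu) for even n and (sqrt 2 1_nu, 1, 0_nu) for odd n,
    so the eigenvector equations are conditions on the blocks of B. *)
Require Import Defs.
From mathcomp Require Import all_boot all_order all_algebra.
From mathcomp Require Import reals.
From mathcomp Require Import ring.

Set Implicit Arguments.
Unset Strict Implicit.
Unset Printing Implicit Defensive.

Import GRing.Theory Num.Theory.
Local Open Scope ring_scope.

(** * Weights as eigenvector equations, and their behaviour under conjugation by a symmetric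
    involution *)

Section Conjugation.
Variable R : realType.

Lemma mulmx_onesE m n (A : 'M[R]_(m, n)) i :
  (A *m ones R n) i 0 = \sum_j A i j.
Proof. by rewrite mxE; apply: eq_bigr => j _; rewrite mxE mulr1. Qed.

(** Column sums of [M] are row sums of [M^T], so both families of sums become matrix equations that
    can be multiplied by [X]. *)
Lemma is_weightE n (M : 'M[R]_n) w :
  is_weight M w <->
  M *m ones R n = (n%:R * w) *: ones R n /\
  M^T *m ones R n = (n%:R * w) *: ones R n.
Proof.
have trE i : \sum_j M^T i j = \sum_j M j i.
  by apply: eq_bigr => j _; rewrite mxE.
split=> [wM | [Me Mte] i].
  split; apply/matrixP=> i k; rewrite (ord1 k) mulmx_onesE ?trE !mxE mulr1;
    by case: (wM i).
by rewrite -trE -!mulmx_onesE Me Mte !mxE mulr1.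
Qed.

Lemma row_sums_zeroE m n (A : 'M[R]_(m, n)) :
  row_sums_zero A <-> A *m ones R n = 0.
Proof.
split=> [A0 | A0 i]; last by rewrite -mulmx_onesE A0 mxE.
by apply/matrixP=> i k; rewrite (ord1 k) mulmx_onesE A0 mxE.
Qed.

(** Multiplying on the left by [X] moves the outer factor to the other side, because [X] is its own
    inverse. As [X] is also symmetric, transposing the product only replaces [B] by [B^T], so one
    argument serves rows and columns. *)
Lemma is_weight_conj n (X B : 'M[R]_n) w :
  X^T = X -> X *m X = 1%:M ->
  is_weight (X *m B *m X) w <->
  B *m (X *m ones R n) = (n%:R * w) *: (X *m ones R n) /\
  B^T *m (X *m ones R n) = (n%:R * w) *: (X *m ones R n).
Proof.
move=> trX XX.
have conjE (C : 'M[R]_n) c :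
    X *m C *m X *m ones R n = c *: ones R n <->
    C *m (X *m ones R n) = c *: (X *m ones R n).
  split=> [/(congr1 (mulmx X)) | CXe].
    by rewrite -!mulmxA mulmxA XX mul1mx -scalemxAr.
  by rewrite -!mulmxA CXe -scalemxAr mulmxA XX mul1mx.
have trE : (X *m B *m X)^T = X *m B^T *m X by rewrite !trmx_mul trX mulmxA.
by split=> [/is_weightE [] | [? ?]]; [|apply/is_weightE; split];
   rewrite ?trE; try move=> /conjE ? /conjE ?; try apply/conjE.
Qed.

End Conjugation.

(** * Symmetry and involutivity of the matrices X_n, and their action on the all-ones vector *)

Section InvolutionX.
Variables (R : realType) (nu : nat).

Local Notation J := (antidiag R nu).
Local Notation e := (ones R nu).
Local Notation r := (Num.sqrt 2 : R).

(** Row [i] of [J] has its only nonzero entry in column [rev_ord i], so the sum defining the product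
    has a single surviving term. *)
Lemma mul_antidiag m (A : 'M[R]_(nu, m)) :
  J *m A = \matrix_(i, j) A (rev_ord i) j.
Proof.
apply/matrixP=> i j; rewrite !mxE (bigD1 (rev_ord i)) //= big1 => [|k kNi].
  by rewrite !mxE rev_ordK eqxx mul1r addr0.
rewrite !mxE; case: eqP => [iE | _]; last by rewrite mul0r.
by rewrite iE rev_ordK eqxx in kNi.
Qed.

Lemma mul_antidiag_antidiag : J *m J = 1%:M.
Proof.
by rewrite mul_antidiag; apply/matrixP=> i j; rewrite !mxE (can_eq rev_ordK).
Qed.

Lemma mul_antidiag_ones : J *m e = e.
Proof. by rewrite mul_antidiag; apply/matrixP=> i j; rewrite !mxE. Qed.

Lemma tr_antidiag : J^T = J.
Proof.
apply/matrixP=> i j; rewrite !mxE; congr (nat_of_bool _)%:R.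
by rewrite -(can_eq rev_ordK) rev_ordK eq_sym.
Qed.

Lemma sqrt2_neq0 : r != 0.
Proof. by rewrite lt0r_neq0 // sqrtr_gt0 ltr0n. Qed.

Lemma sqrt2_sqrt2 : r * r = 2.
Proof. by rewrite -expr2 sqr_sqrtr ?ler0n. Qed.

Lemma invsqrt2_invsqrt2 : r^-1 * r^-1 = 2^-1.
Proof. by rewrite -invfM sqrt2_sqrt2. Qed.

Lemma invsqrt2D : r^-1 + r^-1 = r.
Proof.
apply: (mulIf sqrt2_neq0).
by rewrite mulrDl mulVf ?sqrt2_neq0 // sqrt2_sqrt2.
Qed.

Lemma halfD n : 2^-1 *: 1%:M + 2^-1 *: 1%:M = 1%:M :> 'M[R]_n.
Proof.
by rewrite -scalerDl -[2^-1]mul1r -splitr scale1r.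
Qed.

Lemma ones_col_mx m n : ones R (m + n) = col_mx (ones R m) (ones R n).
Proof.
by rewrite -[LHS]vsubmxK; congr col_mx; apply/matrixP=> i j; rewrite !mxE.
Qed.

Lemma ones1 : ones R 1 = 1.
Proof. by apply/matrixP=> i j; rewrite !ord1 !mxE. Qed.

Lemma tr_X_even : (X_even R nu)^T = X_even R nu.
Proof.
by rewrite /X_even linearZ /= tr_block_mx tr_antidiag raddfN /= trmx1.
Qed.

(** Since [J] squares to the identity, each diagonal block is a sum of two halves of the identity,
    while the off-diagonal blocks cancel by the sign of the last block. *)
Lemma X_even_inv : X_even R nu *m X_even R nu = 1%:M.
Proof.
rewrite /X_even -scalemxAl -scalemxAr scalerA invsqrt2_invsqrt2 mulmx_block.
rewrite mul_antidiag_antidiag !(mul1mx, mulmx1, mulNmx, mulmxN) opprK.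
by rewrite addrN scale_block_mx scaler0 scalerDr halfD -scalar_mx_block.
Qed.

Lemma X_even_ones : X_even R nu *m ones R (nu + nu) = col_mx (r *: e) 0.
Proof.
rewrite /X_even ones_col_mx -scalemxAl mul_block_col mul_antidiag_ones.
by rewrite mulNmx !mul1mx subrr scale_col_mx scaler0 scalerDr -scalerDl invsqrt2D.
Qed.

Lemma tr_block3_mx (A11 : 'M[R]_nu) a12 A13 a21 a22 a23 A31 a32 A33 :
  (block3_mx A11 a12 A13 a21 a22 a23 A31 a32 A33)^T =
  block3_mx A11^T a21^T A31^T a12^T a22 a32^T A13^T a23^T A33^T.
Proof. by rewrite /block3_mx !tr_block_mx tr_row_mx tr_col_mx tr_scalar_mx. Qed.

Lemma mul_block3_col (A11 : 'M[R]_nu) a12 A13 a21 a22 a23 A31 a32 A33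
    m (x : 'M_(nu, m)) y z :
  block3_mx A11 a12 A13 a21 a22 a23 A31 a32 A33 *m col_mx x (col_mx y z) =
  col_mx (A11 *m x + (a12 *m y + A13 *m z))
    (col_mx (a21 *m x + (a22 *: y + a23 *m z))
            (A31 *m x + (a32 *m y + A33 *m z))).
Proof.
rewrite /block3_mx mul_block_col mul_row_col mul_col_mx mul_block_col.
by rewrite mul_scalar_mx add_col_mx.
Qed.

Lemma tr_X_odd : (X_odd R nu)^T = X_odd R nu.
Proof.
by rewrite /X_odd tr_block3_mx !trmx0 raddfN /= !linearZ /= trmx1 tr_antidiag.
Qed.

(** Reading the matrix by block columns reduces a product of two such matrices to three uses of
    [mul_block3_col]. *)
Lemma block3_mx_col (A11 : 'M[R]_nu) a12 A13 a21 a22 a23 A31 a32 A33 :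
  block3_mx A11 a12 A13 a21 a22 a23 A31 a32 A33 =
  row_mx (col_mx A11 (col_mx a21 A31))
    (row_mx (col_mx a12 (col_mx a22%:M a32)) (col_mx A13 (col_mx a23 A33))).
Proof.
rewrite /block3_mx block_mxEh [block_mx a22%:M _ _ _]block_mxEh.
by rewrite -block_mxEv block_mxEh.
Qed.

Lemma block3_mx_surj (B : 'M[R]_(nu + (1 + nu))) :
  exists A11 a12 A13 a21 a22 a23 A31 a32 A33,
    B = block3_mx A11 a12 A13 a21 a22 a23 A31 a32 A33.
Proof.
exists (ulsubmx B), (lsubmx (ursubmx B)), (rsubmx (ursubmx B)).
exists (usubmx (dlsubmx B)), (ulsubmx (drsubmx B) 0 0), (ursubmx (drsubmx B)).
exists (dsubmx (dlsubmx B)), (dlsubmx (drsubmx B)), (drsubmx (drsubmx B)).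
by rewrite /block3_mx -mx11_scalar hsubmxK vsubmxK !submxK.
Qed.

Lemma X_odd_inv : X_odd R nu *m X_odd R nu = 1%:M.
Proof.
rewrite {2}/X_odd block3_mx_col /X_odd !mul_mx_row !mul_block3_col.
rewrite !(mulmx0, mul0mx, scaler0, addr0, add0r, scale1r, mulNmx, mulmxN, opprK).
rewrite -!scalemxAl -!scalemxAr !(mul1mx, mulmx1) mul_antidiag_antidiag.
rewrite !scalerA invsqrt2_invsqrt2 halfD !subrr.
by rewrite -block3_mx_col /block3_mx row_mx0 col_mx0 -!scalar_mx_block.
Qed.

Lemma X_odd_ones :
  X_odd R nu *m ones R (nu + (1 + nu)) = col_mx (r *: e) (col_mx 1 0).
Proof.
rewrite !ones_col_mx ones1 /X_odd mul_block3_col mulNmx -!scalemxAl.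
rewrite !mul0mx mul1mx mul_antidiag_ones scale1r !add0r addr0 subrr.
by rewrite -scalerDl invsqrt2D.
Qed.

End InvolutionX.

(** * The eigenvector equations on the blocks, for even and then for odd size *)

Section Theorem5.
Variables (R : realType) (nu : nat).

Local Notation e := (ones R nu).
Local Notation r := (Num.sqrt 2 : R).

(** The lower half of the vector vanishes, so only the left block column is constrained; the nonzero
    factor [r] cancels. *)
Lemma block_mul_even (A B C D : 'M[R]_nu) c :
  block_mx A B C D *m col_mx (r *: e) 0 = c *: col_mx (r *: e) 0 <->
  A *m e = c *: e /\ C *m e = 0.
Proof.
rewrite mul_block_col !mulmx0 !addr0 scale_col_mx scaler0 -!scalemxAr.
rewrite scalerA mulrC -scalerA; split=> [/eq_col_mx [Ae Ce] | [-> ->]].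
  by split; apply: (scalerI (sqrt2_neq0 R)); rewrite ?scaler0.
by rewrite scaler0.
Qed.

(** The equation for the block matrix constrains [Y] and [W], the one for its transpose [Y^T] and
    [V]. The eigenvalue [2 nu w], read at size [nu], gives [Y] the weight [2 w]. *)
Lemma is_weight_even (Y V W Z : 'M[R]_nu) w :
  is_weight (X_even R nu *m block_mx Y V^T W Z *m X_even R nu) w <->
  [/\ is_weight Y (2 * w), row_sums_zero V & row_sums_zero W].
Proof.
have cE : (nu + nu)%:R * w = nu%:R * (2 * w) by rewrite natrD; ring.
rewrite (is_weight_conj _ _ (tr_X_even R nu) (X_even_inv R nu)) X_even_ones.
rewrite cE tr_block_mx trmxK !block_mul_even.
split=> [[[Ye We] [Yte Ve]] | [/is_weightE [Ye Yte] V0 W0]].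
  by split; [apply/is_weightE | apply/row_sums_zeroE | apply/row_sums_zeroE].
by split; split=> //; apply/row_sums_zeroE.
Qed.

(** The middle entry of the vector is 1, so each of the three block equations can be solved for its
    entry in the middle column. *)
Lemma block3_mul_odd (A11 : 'M[R]_nu) a12 A13 a21 a22 a23 A31 a32 A33 c :
  block3_mx A11 a12 A13 a21 a22 a23 A31 a32 A33 *m
    col_mx (r *: e) (col_mx 1 0) = c *: col_mx (r *: e) (col_mx 1 0) <->
  [/\ a12 = r *: (c *: e - A11 *m e), a22 = c - r * (a21 *m e) 0 0 &
      a32 = - (r *: (A31 *m e))].
Proof.
rewrite mul_block3_col !mulmx0 !mulmx1 !addr0 !scale_col_mx scaler0 -!scalemxAr.
have -> : a22 *: (1 : 'cV[R]_1) = a22%:M by rewrite scalemx1.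
split=> [/eq_col_mx [E1 /eq_col_mx [E2 E3]] | [-> -> ->]].
  split.
  - by rewrite scalerBr [r *: (c *: _)]scalerA mulrC -scalerA -E1 addrC addKr.
  (* Generalising the product keeps [mxE] from expanding it into a sum. *)
  - move: (a21 *m e) E2 => t /matrixP/(_ 0 0).
    by rewrite !mxE !mulr1n mulr1 => <-; rewrite addrAC subrr add0r.
  - by rewrite -[RHS]addr0 -E3 addKr.
congr (col_mx _ (col_mx _ _)).
- by rewrite scalerBr addrC subrK scalerA mulrC -scalerA.
- move: (a21 *m e) => t.
  by apply/matrixP=> i j; rewrite !ord1 !mxE !mulr1n mulr1 addrC subrK.
- by rewrite subrr.
Qed.

Lemma onesmx_ones : onesmx R nu *m e = nu%:R *: e.
Proof.
apply/matrixP=> i j; rewrite !mxE mulr1.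
under eq_bigr do rewrite !mxE mulr1.
by rewrite sumr_const card_ord.
Qed.

Lemma tr_ones_ones : (e^T *m e) 0 0 = nu%:R :> R.
Proof.
rewrite mxE; under eq_bigr do rewrite !mxE mulr1.
by rewrite sumr_const card_ord.
Qed.

(** The family of odd blocks is closed under transposition with the same [w], so the equation for
    the transpose is an instance of the equation for the block itself. *)
Lemma tr_odd_block (V W Y Z : 'M[R]_nu) w :
  (odd_block V W Y Z w)^T = odd_block W V Y^T Z^T w.
Proof.
rewrite /odd_block tr_block3_mx !trmxK; congr block3_mx.
- by rewrite linearD linearZ /= trmx_const.
- by rewrite linearZ /= trmxK.
- by rewrite linearZ.
(* A 1 x 1 matrix equals its transpose, hence [Y] and [Y^T] give the same corner. *)
- congr (_ + 2 * _); transitivity ((e^T *m Y *m e)^T 0 0).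
    by rewrite [RHS]mxE.
  by rewrite !trmx_mul trmxK mulmxA.
- by rewrite raddfN /= linearZ.
- by rewrite raddfN /= linearZ /= trmxK.
Qed.

(** This accounts for the shift by [2 w] times the all-ones matrix: it contributes [2 nu w] to every
    row sum, leaving [w] out of [(2 nu + 1) w]. *)
Lemma odd_row_defect (Y : 'M[R]_nu) w :
  ((nu + (1 + nu))%:R * w) *: e - (Y + (2 * w) *: onesmx R nu) *m e =
  w *: e - Y *m e.
Proof.
rewrite mulmxDl -scalemxAl onesmx_ones scalerA opprD addrCA addrC -scalerBl.
by congr (_ *: _ - _); rewrite !natrD; ring.
Qed.

(** The two factors [r] combine to 2 and [e^T e] is [nu], so [2 nu w] is subtracted from
    [(2 nu + 1) w] and twice the sum of the entries of [Y] is added. *)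
Lemma odd_corner (Y : 'M[R]_nu) w :
  (nu + (1 + nu))%:R * w - r * (r *: (w *: e - Y^T *m e)^T *m e) 0 0 =
  w + 2 * (e^T *m Y *m e) 0 0.
Proof.
rewrite linearB /= linearZ /= trmx_mul trmxK -scalemxAl mulmxBl -scalemxAl.
move: (e^T *m e) (e^T *m Y *m e) tr_ones_ones => p q p00.
by rewrite !mxE p00 mulrA sqrt2_sqrt2 !natrD; ring.
Qed.

Lemma odd_block_mul (V W Y Z : 'M[R]_nu) w :
  odd_block V W Y Z w *m col_mx (r *: e) (col_mx 1 0) =
  ((nu + (1 + nu))%:R * w) *: col_mx (r *: e) (col_mx 1 0).
Proof. by apply/block3_mul_odd; rewrite odd_row_defect odd_corner. Qed.

(** The equation for [B] determines the middle column including the corner, and the equation for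
    [B^T] determines the rest of the middle row; the four outer blocks remain as parameters. *)
Lemma odd_block_surj (B : 'M[R]_(nu + (1 + nu))) w :
  let u := col_mx (r *: e) (col_mx 1 0) in
  let c := (nu + (1 + nu))%:R * w in
  B *m u = c *: u -> B^T *m u = c *: u ->
  exists V W Y Z : 'M[R]_nu, B = odd_block V W Y Z w.
Proof.
move=> u c.
have [A11 [a12 [A13 [a21 [a22 [a23 [A31 [a32 [A33 ->]]]]]]]]] := block3_mx_surj B.
(* Undoes the shift of the upper left block, so that [Y] is arbitrary. *)
pose Y := A11 - (2 * w) *: onesmx R nu.
have A11E : A11 = Y + (2 * w) *: onesmx R nu by rewrite subrK.
have A11tE : A11^T = Y^T + (2 * w) *: onesmx R nu.
  by rewrite A11E linearD linearZ /= trmx_const.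
rewrite tr_block3_mx => /block3_mul_odd [a12E a22E a32E].
case/block3_mul_odd => [a21E _ a23E].
exists A13^T, A31, Y, A33; rewrite /odd_block trmxK -A11E.
have {}a12E : a12 = r *: (w *: e - Y *m e).
  by rewrite a12E A11E odd_row_defect.
have {}a21E : a21 = r *: (w *: e - Y^T *m e)^T.
  by rewrite -[LHS]trmxK a21E A11tE odd_row_defect linearZ.
have {}a23E : a23 = - (r *: (A13^T *m e)^T).
  by rewrite -[LHS]trmxK a23E raddfN /= linearZ.
by rewrite a12E a22E a32E a23E a21E odd_corner.
Qed.

Lemma is_weight_odd (V W Y Z : 'M[R]_nu) w :
  is_weight (X_odd R nu *m odd_block V W Y Z w *m X_odd R nu) w.
Proof.
rewrite (is_weight_conj _ _ (tr_X_odd R nu) (X_odd_inv R nu)) X_odd_ones.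
by rewrite tr_odd_block !odd_block_mul.
Qed.

Lemma in_S_odd (M : 'M[R]_(nu + (1 + nu))) w : is_weight M w ->
  exists V W Y Z : 'M[R]_nu,
    M = X_odd R nu *m odd_block V W Y Z w *m X_odd R nu.
Proof.
pose X := X_odd R nu; have XX : X *m X = 1%:M := X_odd_inv R nu.
(* The matrix to be parametrised is the conjugate of [M], from which [M] is recovered since [X] is
   an involution. *)
have -> : M = X *m (X *m M *m X) *m X.
  by rewrite !mulmxA XX mul1mx -mulmxA XX mulmx1.
rewrite (is_weight_conj _ _ (tr_X_odd R nu) XX) X_odd_ones => -[Bu Btu].
have [V [W [Y [Z BE]]]] := odd_block_surj Bu Btu.
by exists V, W, Y, Z; rewrite -BE.
Qed.

End Theorem5.

Theorem theorem5 (R : realType) (nu : nat) :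
  (forall M : 'M[R]_(nu + nu),
     in_S M <->
     exists Y V W Z : 'M[R]_nu,
       [/\ in_S Y, row_sums_zero V, row_sums_zero W &
           M = X_even R nu *m block_mx Y V^T W Z *m X_even R nu])
  /\
  (forall M : 'M[R]_(nu + (1 + nu)),
     (in_S M <->
      exists (V W Y Z : 'M[R]_nu) (w : R),
        M = X_odd R nu *m odd_block V W Y Z w *m X_odd R nu)
     /\
     (forall (V W Y Z : 'M[R]_nu) (w : R),
        M = X_odd R nu *m odd_block V W Y Z w *m X_odd R nu ->
        is_weight M w)).
Proof.
split=> M; last first.
  split=> [|V W Y Z w ->]; last exact: is_weight_odd.
  split=> [[w /in_S_odd [V [W [Y [Z ME]]]]] | [V [W [Y [Z [w ->]]]]]].
    by exists V, W, Y, Z, w.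
  by exists w; apply: is_weight_odd.
split=> [[w wM] | [Y [V [W [Z [[w wY] V0 W0 ->]]]]]]; last first.
  (* Here [w] is the weight of [Y], which is twice that of the conjugated matrix. *)
  exists (w / 2); apply/is_weight_even; split=> //.
  by rewrite mulrC divfK ?pnatr_eq0.
pose X := X_even R nu; pose B := X *m M *m X.
have ME : M = X *m B *m X.
  by rewrite /B !mulmxA X_even_inv mul1mx -mulmxA X_even_inv mulmx1.
(* The double transpose puts the upper right block into the form [V^T]. *)
move: wM; rewrite ME -(submxK B) -(trmxK (ursubmx B)).
case/is_weight_even=> wY V0 W0.
exists (ulsubmx B), (ursubmx B)^T, (dlsubmx B), (drsubmx B).
by split=> //; exists (2 * w).
Qed.
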